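(* Let $X$ be a non-empty set and $R$ an acyclic binary relation on $X$; put $\mathfrak{P}=(X,R)$. Then the following descriptions of the interval order dimension of $\mathfrak{P}$ are equivalent (they determine the same cardinal): (a) the interval order dimension of $\mathfrak{P}$ is the least cardinal $\lambda$ such that $\overline{R}$ is the intersection of $\lambda$ interval orders; (b) the interval order dimension of $\mathfrak{P}$ is the least cardinal $\lambda$ such that there is a box embedding of $(X,\overline{R})$ into a strict direct product of $\lambda$ interval orders; (c) the interval order dimension of $\mathfrak{P}$ is the least cardinal $\lambda$ such that there is a box embedding of $(X,\overline{R})$ into a direct product of $\lambda$ strong interval orders.
   Context: For a binary relation $R$ on a set $X$, $\overline{R}$ is the transitive closure: $(x,y)\in\overline{R}$ iff there exist $m\geq 1$ and $z_0,\dots,z_m\in X$ with $x=z_0$, $z_m=y$ and $(z_k,z_{k+1})\in R$ for all $0\le k\le m-1$. An $R$-cycle is a non-empty $Y\subseteq X$ such that $(x,y)\in\overline{R}$ and $(y,x)\in\overline{R}$ for all $x,y\in Y$; $R$ is acyclic if there is no $R$-cycle. The asymmetric part is $P(R)=\{(x,y):(x,y)\in R,\ (y,x)\notin R\}$, and $R^*$ is an extension of $R$ if $R\subseteq R^*$ and $P(R)\subseteq P(R^* )$. An interval order is an irreflexive and transitive relation $R$ such that for all $x,y,z,w$, $(x,y)\in R$, $(z,y)\notin R$ and $(z,w)\in R$ imply $(x,w)\in R$. The paper uses as an alternative definition that an interval order $\prec$ on $X$ has an interval representation: an assignment to each $x\in X$ of an open interval $(a_x,b_x)$ of the real line ($a_x<b_x$)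 such that $x\prec y$ iff $b_x\le a_y$. A strong interval order is the reflexive closure $Q\cup\{(x,x):x\in X\}$ of an interval order $Q$. The interval order dimension of $(X,R)$ is the least cardinal $\lambda$ such that there are $\lambda$ interval order extensions of $R$ whose intersection is $\overline{R}$. Given a family of $\lambda$ interval orders indexed by $i<\lambda$ (respectively the strong interval orders which are their reflexive closures), with interval representations $x\mapsto(a_x^i,b_x^i)$, associate to $x\in X$ the box $B(x)=\prod_{i<\lambda}(a_x^i,b_x^i)\subseteq\mathbb{R}^\lambda$. The strict direct product is ordered by $\prec_S$: $B(x)\prec_S B(y)$ iff $b_x^i\le a_y^i$ for all $i<\lambda$. The direct product (of strong interval orders) is ordered by $\preceq_Q$: $B(x)\preceq_Q B(y)$ iff for all $i<\lambda$, either $b_x^i\le a_y^i$, or $a_x^i=a_y^i$ and $b_x^i=b_y^i$; write $\prec_Q$ for the asymmetric part of $\preceq_Q$. A box embedding of $(X,\overline{R})$ into the strict direct product (respectively direct product) is such an assignment $x\mapsto B(x)$ satisfying, for all $x,y\in X$: $x\overline{R}y$ iff $B(x)\prec_S B(y)$ (respectively iff $B(x)\prec_Q B(y)$).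
   Formalization: Real boxes in (b), (c) are treated assuming every interval order on X has a real interval representation (else intervals in arbitrary linear orders); in (c) λ ≥ 1 and distinct points must get distinct intervals in each coordinate. Without these the claim fails. *)

(* Defs.v *)
From Stdlib Require Import Relation_Definitions Relation_Operators.
From mathcomp Require Import all_boot all_order all_algebra.
From mathcomp Require Import boolp classical_sets functions cardinality reals.

Set Implicit Arguments.
Unset Strict Implicit.
Unset Printing Implicit Defensive.

Import Order.TTheory GRing.Theory Num.Theory.

Local Open Scope classical_set_scope.

Section Relations.
Variable X : Type.
Implicit Types r s Q : relation X.

Definition is_cycle r (Y : set X) : Prop :=
  Y !=set0 /\
  forall x y, Y x -> Y y -> clos_trans X r x y /\ clos_trans X r y x.

Definition acyclic r : Prop := ~ exists Y : set X, is_cycle r Y.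

Definition asym_part r : relation X := fun x y => r x y /\ ~ r y x.

Definition extension r s : Prop :=
  (forall x y, r x y -> s x y) /\
  (forall x y, asym_part r x y -> asym_part s x y).

Definition interval_order Q : Prop :=
  [/\ forall x, ~ Q x x,
      forall x y z, Q x y -> Q y z -> Q x z &
      forall x y z w, Q x y -> ~ Q z y -> Q z w -> Q x w].

Definition reflexive_closure Q : relation X := fun x y => Q x y \/ x = y.

End Relations.

(* A cardinal is given by an index type; families may have repetitions, which
   does not affect least cardinals. *)
Definition least_cardinal (P : Type -> Prop) (I : Type) : Prop :=
  P I /\ forall J : Type, P J -> ([set: I] #<= [set: J])%card.

Definition is_intersection (X I : Type) (r : relation X)
    (Q : I -> relation X) : Prop :=
  forall x y, r x y <-> forall i, Q i x y.

Definition extension_realizer (X : Type) (r : relation X) (I : Type) : Prop :=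
  exists Q : I -> relation X,
    (forall i, interval_order (Q i) /\ extension r (Q i)) /\
    is_intersection (clos_trans X r) Q.

Definition is_interval_order_dimension (X : Type) (r : relation X)
    (I : Type) : Prop :=
  least_cardinal (extension_realizer r) I.

Definition interval_order_realizer (X : Type) (r : relation X)
    (I : Type) : Prop :=
  exists Q : I -> relation X,
    (forall i, interval_order (Q i)) /\ is_intersection (clos_trans X r) Q.

Section Representations.
Context {d : Order.disp_t} {T : orderType d} {X : Type}.
Local Open Scope order_scope.

Definition interval_representation (Q : relation X) (a b : X -> T) : Prop :=
  (forall x, a x < b x) /\ (forall x y, Q x y <-> b x <= a y).

(* When [S] is the reflexive closure of an interval order, this forces distinct
   points to have distinct intervals. *)
Definition strong_interval_representation (S : relation X)
    (a b : X -> T) : Prop :=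
  (forall x, a x < b x) /\
  (forall x y, S x y <-> b x <= a y \/ (a x = a y /\ b x = b y)).

End Representations.

Definition representable {d : Order.disp_t} (T : orderType d) (X : Type)
    (Q : relation X) : Prop :=
  exists a b : X -> T, interval_representation Q a b.

(* The open box with i-th side the interval (lo i, hi i) of the line L i. For
   boxes in a power of the real line, L is constantly the reals. *)
Record box (I : Type) (d : Order.disp_t) (L : I -> orderType d) := Box {
  lo : forall i, L i;
  hi : forall i, L i;
  lo_lt_hi : forall i, (lo i < hi i)%O }.

Section Products.
Context {I : Type} {d : Order.disp_t} {L : I -> orderType d}.
Implicit Types B C : box L.
Local Open Scope order_scope.

Definition strict_product_lt : relation (box L) :=
  fun B C => forall i, hi B i <= lo C i.

Definition product_le : relation (box L) :=
  fun B C => forall i, hi B i <= lo C i \/ (lo B i = lo C i /\ hi B i = hi C i).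

Definition product_lt : relation (box L) := asym_part product_le.

End Products.

Section Embeddings.
Context {X I : Type} {d : Order.disp_t}.
Variables (r : relation X) (L : I -> orderType d).

Definition embeds_in_strict_product : Prop :=
  exists (Q : I -> relation X) (B : X -> box L),
    (forall i, interval_order (Q i) /\
       interval_representation (Q i) (fun x => lo (B x) i)
                                     (fun x => hi (B x) i)) /\
    (forall x y, clos_trans X r x y <-> strict_product_lt (B x) (B y)).

(* Products are taken over non-empty index types: in the empty product the
   relation [product_lt] is empty, so an antichain would embed in it. *)
Definition embeds_in_product : Prop :=
  inhabited I /\
  exists (Q : I -> relation X) (B : X -> box L),
    (forall i, interval_order (Q i) /\
       strong_interval_representation (reflexive_closure (Q i))
         (fun x => lo (B x) i) (fun x => hi (B x) i)) /\
    (forall x y, clos_trans X r x y <-> product_lt (B x) (B y)).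

End Embeddings.

Definition real_strict_box_embedding (R : realType) (X : Type)
    (r : relation X) (I : Type) : Prop :=
  embeds_in_strict_product r (fun _ : I => R : orderType _).

Definition real_box_embedding (R : realType) (X : Type)
    (r : relation X) (I : Type) : Prop :=
  embeds_in_product r (fun _ : I => R : orderType _).

Definition linear_strict_box_embedding (X : Type)
    (r : relation X) (I : Type) : Prop :=
  exists (d : Order.disp_t) (L : I -> orderType d),
    embeds_in_strict_product r L.

Definition linear_box_embedding (X : Type)
    (r : relation X) (I : Type) : Prop :=
  exists (d : Order.disp_t) (L : I -> orderType d), embeds_in_product r L.

(* Main.v *)
Require Import Defs.
From Stdlib Require Import Relation_Definitions Relation_Operators.
From HB Require Import structures.
From mathcomp Require Import all_boot all_order all_algebra reals.
From mathcomp Require Import boolp classical_sets wochoice lra.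

Set Implicit Arguments.
Unset Strict Implicit.
Unset Printing Implicit Defensive.

Import Order.TTheory GRing.Theory Num.Theory.

(** The classes of index types whose least cardinals are compared contain exactly
    the same types, the real ones under the representability hypothesis: membership
    of [I] always amounts to [interval_order_realizer], that is, the transitive
    closure of [r] is an intersection of interval orders indexed by [I].
    Acyclicity makes this closure irreflexive, so that [I] is then inhabited.

    For extensions this holds because an interval order is asymmetric, so that
    any interval order containing [r] contains [r] as asymmetric pairs as well.
    For boxes, comparing two boxes side by side is comparing the two points in
    every interval order.  In the strict product this is immediate; in the
    product ([product_ltP]) the equality alternative can be used by two
    distinct points on no side, since it would make their intervals equal, while
    a strong representation separates points.

    The content lies in finding intervals for given interval orders, with
    distinct points receiving distinct intervals as the product requires.  To
    the endpoints of the interval of [x] are attached two down-sets: the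
    predecessors of [x] for the left one, and the common predecessors of all
    successors of [x] for the right one.  The interval order axiom says that
    these sets form a chain, and [Q x y] holds iff the right set of [x] lies in
    the left set of [y].  Where several endpoints have the same set, right
    endpoints are put before left ones, so that this equivalence survives, and
    endpoints of the same kind are separated by a well-ordering of [X].  The
    outcome [endpoint_le] is a total order on all the endpoints, in which no two
    of them coincide.

    This order is itself the line sought when any linear order may serve.  For
    real intervals, the representability hypothesis is applied to a total order
    on [X]: its intervals are pairwise disjoint and each contains a rational, so
    [X] is countable.  Then so is the set of endpoints, and a countable total
    order embeds in the reals: send an element to the real whose binary digits
    mark the codes of the elements up to it ([countable_order_embeds]). *)

Local Open Scope classical_set_scope.

(** * Total orders *)

Lemma total_order_exists (X : Type) : exists le : rel X, total_order le.
Proof.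
have [le le_wo] := well_ordering_principle {classic X}.
exists le; have le_woT : wo_chain le predT by move=> A _; exact: le_wo.
split; last by move=> x y; apply: (wo_chainW le_woT).
have le_tot : total le by move=> x y; apply: (wo_chainW le_woT).
have le_anti : antisymmetric le.
  by move=> x y; apply: (wo_chain_antisymmetric le_woT).
split=> //; split=> [x|y x z xy yz]; first by have /orP[] := le_tot x x.
(* Transitivity is read off the minimum of the three points. *)
have [|m [[Am mlb] _]] :=
    le_wo [pred u : {classic X} | `[< [\/ u = x, u = y | u = z] >]].
  by exists x; apply/asboolP; constructor 1.
have lb u : [\/ u = x, u = y | u = z] -> le m u by move=> ?; apply/mlb/asboolP.
case/asboolP: Am => mE; first by rewrite -mE; apply: lb; constructor 3.
  have -> : x = y by apply: le_anti; rewrite xy -mE lb //; constructor 1.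
  by [].
have <- : y = z by apply: le_anti; rewrite yz -mE lb //; constructor 2.
by [].
Qed.

(** A copy of [T] on which [le] can be declared as the canonical order. *)
Definition ordered_by (T : Type) (le : rel T) of total_order le := T.

Section OrderedBy.
Context (T : Type) (le : rel T) (le_total : total_order le).

HB.instance Definition _ := gen_eqMixin (ordered_by le_total).
HB.instance Definition _ := gen_choiceMixin (ordered_by le_total).
HB.instance Definition _ :=
  @Order.Le_isPOrder.Build (Order.Disp tt tt) (ordered_by le_total)
    le le_total.1.1.1 le_total.1.2 le_total.1.1.2.
HB.instance Definition _ :=
  @Order.POrder_isTotal.Build (Order.Disp tt tt) (ordered_by le_total)
    le_total.2.

End OrderedBy.

(** * Countable total orders in the reals *)

Section CountableOrders.
Context {R : realType}.
Implicit Types (A B : set nat).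
Local Open Scope ring_scope.

Definition binary_digit A (i : nat) : R := if `[< A i >] then 2^-1 ^+ i.+1 else 0.

(** The series of the digits, as a supremum since its terms are nonnegative. *)
Definition binary_expansion A : R :=
  sup (range (fun k : nat => \sum_(i < k) binary_digit A i)).

Lemma binary_digit_ge0 A i : 0 <= binary_digit A i.
Proof. by rewrite /binary_digit; case: ifP => // _; rewrite exprn_ge0 ?invr_ge0. Qed.

Lemma binary_expansion_bounded A :
  has_sup (range (fun k : nat => \sum_(i < k) binary_digit A i)).
Proof.
split; first by exists 0, 0%N => //; rewrite big_ord0.
exists 1 => _ [k _ <-]; apply: (@le_trans _ _ (1 - 2^-1 ^+ k)); last first.
  by rewrite lerBlDr lerDl exprn_ge0 ?invr_ge0.
elim: k => [|k IH]; first by rewrite big_ord0 expr0 subrr.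
have : binary_digit A k <= 2^-1 ^+ k.+1.
  by rewrite /binary_digit; case: ifP => // _; rewrite exprn_ge0 ?invr_ge0.
by rewrite big_ord_recr /= exprS; lra.
Qed.

(** Every partial sum for [A], increased by the digit of weight [2^-(i+1)], is
    below a partial sum for [B]; the gap survives passing to the supremum.  It
    is strict although binary expansions are not unique, because the digits are
    compared one by one. *)
Lemma lt_binary_expansion A B i :
  A `<=` B -> ~ A i -> B i -> binary_expansion A < binary_expansion B.
Proof.
move=> AB nAi Bi.
have lt0 : 0 < 2^-1 ^+ i.+1 :> R by rewrite exprn_gt0 ?invr_gt0.
suff : binary_expansion A <= binary_expansion B - 2^-1 ^+ i.+1 by lra.
apply: ge_sup => [|_ [k _ <-]]; first by case: (binary_expansion_bounded A).
rewrite lerBrDr.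
(* [i.+1 + k] terms reach the digit [i] and contain the [k] given terms. *)
apply: (@le_trans _ _ (\sum_(j < i.+1 + k) binary_digit B j)); last first.
  apply: ub_le_sup; first by case: (binary_expansion_bounded B).
  by exists (i.+1 + k)%N.
have digit_le j : binary_digit A j <= binary_digit B j.
  rewrite /binary_digit; case: asboolP => [/AB Bj|_]; first by rewrite asboolT.
  exact: binary_digit_ge0.
apply: (@le_trans _ _ (\sum_(j < i.+1 + k) binary_digit A j + 2^-1 ^+ i.+1)).
  rewrite lerD2r addnC big_split_ord /= lerDl.
  by apply: sumr_ge0 => j _; exact: binary_digit_ge0.
have iP : (i < i.+1 + k)%N by rewrite addSn ltnS leq_addr.
rewrite (bigD1 (Ordinal iP)) //= [leRHS](bigD1 (Ordinal iP)) //=.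
have -> : binary_digit A i = 0 by rewrite /binary_digit asboolF.
have -> : binary_digit B i = 2^-1 ^+ i.+1 by rewrite /binary_digit asboolT.
by rewrite add0r [leLHS]addrC lerD2l; apply: ler_sum => j _.
Qed.

Lemma countable_order_embeds (T : Type) (le : rel T) (code : T -> nat) :
  total_order le -> injective code ->
  exists g : T -> R, forall e f, le e f <-> g e <= g f.
Proof.
move=> [[[le_refl le_trans] le_anti] le_tot] code_inj.
pose below e := [set code f | f in [set f | le f e]].
have belowS e f : le e f -> below e `<=` below f.
  by move=> ef _ [h he <-]; exists h => //=; apply: le_trans ef.
exists (binary_expansion \o below) => e f /=; split.
  move=> ef; case: (boolP (le f e)) => [fe|/negP nfe].
    by have -> : e = f by apply: le_anti; rewrite ef.
  apply/ltW/(@lt_binary_expansion _ _ (code f)); first exact: belowS.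
    by case=> h he /code_inj hf; apply: nfe; rewrite -hf.
  by exists f => //=.
move=> gef; apply/negPn/negP => /negP nef.
have fe : le f e by have /orP[/nef|] := le_tot e f.
move: gef; rewrite leNgt => /negP; apply.
apply: (@lt_binary_expansion _ _ (code e)); first exact: belowS.
  by case=> h he /code_inj hf; apply: nef; rewrite -hf.
by exists e => //=.
Qed.

End CountableOrders.

(** * The order on the endpoints of an interval order *)

Section Endpoints.
Context {X : Type} (Q : relation X) (Q_io : interval_order Q).
Context (tie : rel X) (tie_total : total_order tie).

(** The pair of a point and a boolean is its right endpoint if the boolean is
    [true], and its left endpoint otherwise. *)
Definition endpoint_cut (e : X * bool) : set X :=
  if e.2 then [set z | forall y, Q e.1 y -> Q z y] else [set z | Q z e.1].

(** A right endpoint precedes any left endpoint with the same cut: open intervals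
    that merely touch are comparable. *)
Definition endpoint_tie (e f : X * bool) : bool :=
  if e.2 == f.2 then tie e.1 f.1 else e.2.

Definition endpoint_le : rel (X * bool) := fun e f =>
  `[< endpoint_cut e `<=` endpoint_cut f >] &&
  (`[< endpoint_cut f `<=` endpoint_cut e >] ==> endpoint_tie e f).

Lemma endpoint_tie_total : total_order endpoint_tie.
Proof.
case: tie_total => [[[tie_refl tie_trans] tie_anti] tie_tot].
split; last first.
  by move=> [x []] [y []]; rewrite /endpoint_tie //=.
split; last first.
  by move=> [x []] [y []]; rewrite /endpoint_tie //= => /tie_anti ->.
split; first by move=> [x b]; rewrite /endpoint_tie /= eqxx.
by move=> [y []] [x []] [z []]; rewrite /endpoint_tie //=; exact: tie_trans.
Qed.

(** The sets of predecessors form a chain by the interval order axiom; the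
    remaining cuts are intersections of such sets, and intersections of members
    of a chain are comparable. *)
Lemma endpoint_cut_total e f :
  endpoint_cut e `<=` endpoint_cut f \/ endpoint_cut f `<=` endpoint_cut e.
Proof.
case: Q_io => _ _ Q_inter.
have pred_total x y u v : Q u x -> ~ Q u y -> Q v y -> Q v x.
  by move=> ux nuy vy; exact: Q_inter vy nuy ux.
have [|nef] := pselect (endpoint_cut e `<=` endpoint_cut f); first by left.
right=> v fv; have [u eu nfu] : exists2 u, endpoint_cut e u & ~ endpoint_cut f u.
  apply: contrapT => none; apply: nef => u eu.
  by apply: contrapT => nfu; apply: none; exists u.
case: e f {nef} eu nfu fv => [x []] [y []]; rewrite /endpoint_cut /=.
- move=> xu nyu yv w xw.
  apply: contrapT => nvw; apply: nyu => w' yw'.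
  by apply: (pred_total _ w v) (xu w xw) => //; exact: yv.
- move=> xu nuy vy w xw.
  by apply: (pred_total _ y u) vy => //; exact: xu.
- move=> ux nyu yv; apply: contrapT => nvx; apply: nyu => w yw.
  by apply: (pred_total _ x v) ux => //; exact: yv.
- exact: pred_total.
Qed.

Lemma endpoint_le_total : total_order endpoint_le.
Proof.
have [[[t_refl t_trans] t_anti] t_tot] := endpoint_tie_total.
split; last first.
  move=> e f; rewrite /endpoint_le.
  case: asboolP => fe; case: asboolP => ef //=; last by case: (endpoint_cut_total e f).
split; last first.
  move=> e f; rewrite /endpoint_le.
  by case: asboolP; case: asboolP => //= _ _; exact: t_anti.
split.
  by move=> e; rewrite /endpoint_le t_refl implybT andbT; apply/asboolP.
move=> f e g /andP[/asboolP ef tef] /andP[/asboolP fg tfg].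
rewrite /endpoint_le asboolT /=; last exact: subset_trans fg.
apply/implyP => /asboolP ge.
rewrite asboolT /= in tef; last exact: subset_trans ge.
rewrite asboolT /= in tfg; last exact: subset_trans ef.
exact: t_trans tfg.
Qed.

(** A point lies in its own right cut, which gives the direction from cuts to
    [Q]; the order chosen between equal cuts makes the tie condition vacuous. *)
Lemma endpoint_leP x y : Q x y <-> endpoint_le (x, true) (y, false).
Proof.
rewrite /endpoint_le /endpoint_tie implybT andbT /endpoint_cut /=; split.
  by move=> xy; apply/asboolP => z; apply.
by move=> /asboolP; apply=> w.
Qed.

End Endpoints.

(** * Representations separating the points *)

(** Distinct left endpoints are what makes the same intervals usable in the
    direct product of strong interval orders. *)
Definition separated_representation {d : Order.disp_t} {T : orderType d}
    {X : Type} (Q : relation X) (a b : X -> T) : Prop :=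
  interval_representation Q a b /\ injective a.

(** Nonemptiness of the intervals comes for free: it is irreflexivity of [Q]. *)
Lemma endpoint_separated_representation {d : Order.disp_t} {T : orderType d}
    {X : Type} (Q : relation X) (tie : rel X) (g : X * bool -> T) :
  interval_order Q -> total_order tie ->
  (forall e f, endpoint_le Q tie e f <-> (g e <= g f)%O) ->
  separated_representation Q (fun x => g (x, false)) (fun x => g (x, true)).
Proof.
move=> Q_io tie_total gP; split; last first.
  move=> x y gxy; have [[_ le_anti] _] := endpoint_le_total Q_io tie_total.
  have /le_anti[] // : endpoint_le Q tie (x, false) (y, false) &&
    endpoint_le Q tie (y, false) (x, false).
  by apply/andP; split; apply/gP; rewrite gxy.
have QP x y : Q x y <-> (g (x, true) <= g (y, false))%O.
  by rewrite -gP; exact: endpoint_leP.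
split=> // x; rewrite ltNge; apply/negP => /QP.
by case: Q_io => Q_irr _ _; exact: Q_irr.
Qed.

Lemma separated_strong {d : Order.disp_t} {T : orderType d} {X : Type}
    (Q : relation X) (a b : X -> T) :
  separated_representation Q a b ->
  strong_interval_representation (reflexive_closure Q) a b.
Proof.
move=> [[ab QP] a_inj]; split=> // x y; split.
  by case=> [/QP|->]; [left|right].
by case=> [/QP|[/a_inj xy _]]; [left|right].
Qed.

Lemma strict_total_interval_order (X : Type) (le : rel X) :
  total_order le -> interval_order (fun x y => ~~ le y x).
Proof.
move=> [[[le_refl le_trans] _] le_tot].
have leW x y : ~~ le y x -> le x y by have /orP[//|->] := le_tot x y.
split=> [x|x y z|x y z w]; first by rewrite le_refl.
  move=> yx zy; apply: contra zy => zx; apply: (le_trans x) => //.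
  exact: leW.
move=> yx /negP; rewrite negbK => yz wz; apply: contra yx => wx.
by apply: (le_trans z) => //; apply: (le_trans w) => //; exact: leW.
Qed.

(** The intervals representing a total order are pairwise disjoint, so that
    choosing a rational in each of them is injective. *)
Lemma representable_order_countable (R : realType) (X : Type) (le : rel X) :
  total_order le -> representable R (fun x y => ~~ le y x) ->
  exists code : X -> nat, injective code.
Proof.
move=> [[_ le_anti] _] [a [b [ab leP]]].
have /choice[q qP] x : exists q : rat, ratr q \in `]a x, b x[%R.
  exact: rat_in_itvoo.
exists (pickle \o q); apply: inj_comp; first exact: (pcan_inj pickleK).
have disjoint x y : q x = q y -> le y x.
  move=> qxy; apply/negPn/negP => /leP bxay.
  have := qP x; have := qP y; rewrite !in_itv /= -qxy => /andP[ay _] /andP[_ bx].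
  by have := lt_trans (lt_le_trans bx bxay) ay; rewrite ltxx.
by move=> x y qxy; apply: le_anti; rewrite !disjoint.
Qed.

Lemma real_separated_representation (R : realType) (X : Type) :
  (forall Q : relation X, interval_order Q -> representable R Q) ->
  forall Q : relation X, interval_order Q ->
  exists a b : X -> R, separated_representation Q a b.
Proof.
move=> repr Q Q_io; have [tie tie_total] := total_order_exists X.
have [code code_inj] :=
  representable_order_countable tie_total
    (repr _ (strict_total_interval_order tie_total)).
have code2_inj : injective (fun e : X * bool => pickle (code e.1, e.2)).
  by move=> [x b] [y c] /(pcan_inj pickleK) [/code_inj -> ->].
have [g gP] := @countable_order_embeds R _ _ _
  (endpoint_le_total Q_io tie_total) code2_inj.
by exists (fun x => g (x, false)), (fun x => g (x, true));
  exact: endpoint_separated_representation gP.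
Qed.

Lemma linear_separated_representation (X I : Type) (Q : I -> relation X) :
  (forall i, interval_order (Q i)) ->
  exists (d : Order.disp_t) (L : I -> orderType d),
    forall i, exists a b : X -> L i, separated_representation (Q i) a b.
Proof.
move=> Q_io; have [tie tie_total] := total_order_exists X.
exists (Order.Disp tt tt).
exists (fun i => ordered_by (endpoint_le_total (Q_io i) tie_total)).
move=> i; exists (fun x => (x, false)), (fun x => (x, true)).
exact: (@endpoint_separated_representation _
  (ordered_by (endpoint_le_total (Q_io i) tie_total)) X (Q i) tie id).
Qed.

(** * Box embeddings *)

Section Boxes.
Context {X I : Type} {d : Order.disp_t} {L : I -> orderType d}.
Implicit Types (r : relation X) (Q : I -> relation X).

(** Since each side of the box of [x] alone determines [x], the equality
    alternative is used either on every side, when [x = y], or on none; the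
    asymmetric part removes the former.  An index is needed for the asymmetric
    part to retain the latter. *)
Lemma product_ltP Q (B : X -> box L) x y :
  inhabited I ->
  (forall i, interval_order (Q i) /\
     strong_interval_representation (reflexive_closure (Q i))
       (fun x => lo (B x) i) (fun x => hi (B x) i)) ->
  product_lt (B x) (B y) <-> forall i, Q i x y.
Proof.
move=> [i0] QB.
have leP u v : product_le (B u) (B v) <-> forall i, Q i u v \/ u = v.
  by split=> le_uv i; have [_ [_ QP]] := QB i; apply/QP; exact: le_uv.
split=> [[/leP le_xy n_le_yx] i|lt_xy].
  by have [//|xy] := le_xy i; case: n_le_yx; apply/leP => j; right.
split; first by apply/leP => i; left.
move=> /leP /(_ i0); have [[Q_irr Q_trans _] _] := QB i0.
case=> [yx|yx]; first exact: (Q_irr x (Q_trans _ _ _ (lt_xy i0) yx)).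
by move: (lt_xy i0); rewrite yx; exact: Q_irr.
Qed.

Lemma strict_product_realizer r :
  embeds_in_strict_product r L -> interval_order_realizer r I.
Proof.
move=> [Q [B [QB rB]]]; exists Q; split=> [i|x y]; first by case: (QB i).
rewrite rB; split=> xy i; first by have [_ [_ QP]] := QB i; apply/QP.
by have [_ [_ QP]] := QB i; apply/QP.
Qed.

Lemma product_realizer r :
  embeds_in_product r L -> interval_order_realizer r I.
Proof.
move=> [I0 [Q [B [QB rB]]]]; exists Q; split=> [i|x y]; first by case: (QB i).
by rewrite rB (product_ltP _ _ I0 QB).
Qed.

(** The same boxes serve for both products. *)
Lemma realizer_embeds r Q :
  (forall i, interval_order (Q i)) -> is_intersection (clos_trans X r) Q ->
  (forall i, exists a b : X -> L i, separated_representation (Q i) a b) ->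
  embeds_in_strict_product r L /\ (inhabited I -> embeds_in_product r L).
Proof.
move=> Q_io rQ repr.
pose a i := projT1 (cid (repr i)).
pose b i := projT1 (cid (projT2 (cid (repr i)))).
have abP i : separated_representation (Q i) (a i) (b i).
  exact: projT2 (cid (projT2 (cid (repr i)))).
pose B x := Box (fun i => (abP i).1.1 x).
split=> [|I0].
  exists Q, B; split=> [i|x y]; first by split=> //; case: (abP i).
  by rewrite rQ; split=> xy i; have [[_ QP] _] := abP i; apply/QP; exact: xy.
have QB i : interval_order (Q i) /\
    strong_interval_representation (reflexive_closure (Q i))
      (fun x => lo (B x) i) (fun x => hi (B x) i).
  by split=> //; exact: separated_strong (abP i).
split=> //; exists Q, B; split=> // x y.
by rewrite (product_ltP _ _ I0 QB); exact: rQ.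
Qed.

End Boxes.

(** * Comparison of the dimensions *)

Lemma acyclic_clos_trans (X : Type) (r : relation X) (x : X) :
  acyclic r -> ~ clos_trans X r x x.
Proof.
move=> r_acyclic xx; apply: r_acyclic; exists [set x]; split; first by exists x.
by move=> _ _ -> ->.
Qed.

(** The intersection of the empty family is the full relation, which is not
    irreflexive. *)
Lemma realizer_inhabited (X : Type) (r : relation X) (I : Type) :
  inhabited X -> acyclic r -> interval_order_realizer r I -> inhabited I.
Proof.
move=> [x] r_acyclic [Q [_ rQ]]; apply: contrapT => I0.
by apply: (acyclic_clos_trans (x := x) r_acyclic); apply: (rQ x x).2 => i; case: I0.
Qed.

Lemma extension_realizerP (X : Type) (r : relation X) (I : Type) :
  extension_realizer r I <-> interval_order_realizer r I.
Proof.
split=> [[Q [QE rQ]]|[Q [Q_io rQ]]]; exists Q; split=> // i.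
  by case: (QE i).
have rQi x y : r x y -> Q i x y by move=> xy; apply: (rQ x y).1; exact: t_step.
split=> //; split=> // x y [/rQi xy _]; split=> // yx.
by have [Q_irr Q_trans _] := Q_io i; exact: (Q_irr x (Q_trans _ _ _ xy yx)).
Qed.

Lemma least_cardinal_equiv (P P' : Type -> Prop) (I : Type) :
  (forall J, P J <-> P' J) -> least_cardinal P I <-> least_cardinal P' I.
Proof.
move=> PP'; split=> -[PI Imin]; split; try exact/PP'.
  by move=> J /PP'; exact: Imin.
by move=> J /PP'; exact: Imin.
Qed.

(* A linear order on an uncountable X has no representation by non-degenerate
   real intervals, so the real form of (b) and (c) needs the representability
   of interval orders on X as a hypothesis; for arbitrary X the intervals are
   taken in linear orders. *)
Theorem theorem4p13 (R : realType) (X : Type) (X_nonempty : inhabited X)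
    (r : relation X) (r_acyclic : acyclic r) :
  (* (a) *)
  (forall I : Type, is_interval_order_dimension r I <->
     least_cardinal (interval_order_realizer r) I) /\
  (* (b) and (c), intervals of the real line *)
  ((forall Q : relation X, interval_order Q -> representable R Q) ->
   (forall I : Type, is_interval_order_dimension r I <->
      least_cardinal (real_strict_box_embedding R r) I) /\
   (forall I : Type, is_interval_order_dimension r I <->
      least_cardinal (real_box_embedding R r) I)) /\
  (* (b) and (c), intervals of linear orders *)
  (forall I : Type, is_interval_order_dimension r I <->
     least_cardinal (linear_strict_box_embedding r) I) /\
  (forall I : Type, is_interval_order_dimension r I <->
     least_cardinal (linear_box_embedding r) I).
Proof.
have dimP P : (forall J, interval_order_realizer r J <-> P J) ->
    forall I, is_interval_order_dimension r I <-> least_cardinal P I.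
  move=> realP I; apply: least_cardinal_equiv => J.
  exact: iff_trans (extension_realizerP r J) (realP J).
split; first exact: dimP.
split=> [repr|].
  have real_repr := real_separated_representation repr.
  split; apply: dimP => J; split=> [rJ|].
  - have [Q [Q_io rQ]] := rJ.
    exact: (realizer_embeds Q_io rQ (fun i => real_repr _ (Q_io i))).1.
  - exact: strict_product_realizer.
  - have [Q [Q_io rQ]] := rJ.
    apply: (realizer_embeds Q_io rQ (fun i => real_repr _ (Q_io i))).2.
    exact: realizer_inhabited rJ.
  - exact: product_realizer.
split; apply: dimP => J; split=> [rJ|].
- have [Q [Q_io rQ]] := rJ.
  have [d [L repr]] := linear_separated_representation Q_io.
  by exists d, L; exact: (realizer_embeds Q_io rQ repr).1.
- by move=> [d [L]]; exact: strict_product_realizer.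
- have [Q [Q_io rQ]] := rJ.
  have [d [L repr]] := linear_separated_representation Q_io.
  exists d, L; apply: (realizer_embeds Q_io rQ repr).2.
  exact: realizer_inhabited rJ.
- by move=> [d [L]]; exact: product_realizer.
Qed.
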